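(* For a tensor network with green and real leaves and a binary contraction tree $T$ over it, let $V(T)$ be the real-skeleton volume, $m(T)$ and $r(T)$ the merge and ride volume fractions, and $C(T) = \bigl(1 + 2m(T) + r(T)\bigr)V(T)$ the realified cost; let $V^* = \min_T V(T)$ and $C^* = \min_T C(T)$ over all binary contraction trees. Call $T_0$ skeleton-optimal if $V(T_0) = V^*$. For every $\epsilon > 0$ there is a family of networks, each with exactly $n_c = 2$ green leaves and with a unique skeleton-optimal tree $T_0$, such that $$C(T_0) \ge (2 - \epsilon)\, C^*.$$ Moreover, no ratio $C(T_0)/C^*$ above $3$ is possible for any network: every skeleton-optimal tree $T_0$ of any network satisfies $C(T_0) \le 3V^* \le 3\,C^*$.
   Context: A tensor network is a finite collection of at least two tensors (leaves) whose axes are labelled by indices; each index has a dimension $\ge 1$, some indices are designated open, and every non-open index appears on at least two tensors. Each leaf is either green (complex) or real, and $n_c \ge 1$ denotes the number of green leaves. A binary contraction tree is a full binary tree whose leaves are the tensors of the network (the two children of a node are unordered, so trees differing only by swapping children are identified); each internal node is a pairwise contraction step whose operands are the tensors at its two children. The tensor at a node whose subtree contains the leaf set $S$ carries exactly those indices that appear on some leaf in $S$ and are either open or also appear on a leaf outside $S$. The volume of a step is the product of the dimensions of all indices occurring on at least one of its two operands (contractions of operands sharing no index are allowed and priced the same way). The real-skeleton volume $V(T)$ is the sum of the volumes of all steps of $T$. An operand is green if and only if its subtree contains at least one green leaf; a step is a merge if both operands are green, a ride if exactly one is, and a pass if neither is. The fractions $m(T)$ and $r(T)$ are the shares of $V(T)$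 carried by merge steps and by ride steps. *)

(* Defs.v *)
From Stdlib Require List.
From mathcomp Require Import all_boot all_order all_algebra.
From mathcomp Require Import boolp reals.

Set Implicit Arguments.
Unset Strict Implicit.
Unset Printing Implicit Defensive.

Import Order.TTheory GRing.Theory Num.Theory.

(* Only the set of indices occurring on a tensor matters for contraction
   volumes, so the axes of a tensor are recorded as a set of indices. *)
Record network := Network {
  tensor : finType;
  ix : finType;
  dim : ix -> nat;
  axes : tensor -> {set ix};
  open_ix : {set ix};
  green : {set tensor};
  tensor_gt1 : 1 < #|tensor|;
  dim_gt0 : forall i, 0 < dim i;
  ix_used : forall i, exists x, i \in axes x;
  closed_ix_shared : forall i, i \notin open_ix ->
    1 < #|[set x | i \in axes x]|;
  green_gt0 : 0 < #|green|
}.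

Definition isomorphic (N M : network) : Prop :=
  exists (f : tensor N -> tensor M) (g : ix N -> ix M),
    [/\ bijective f,
        bijective g,
        forall i, dim (g i) = dim i &
    [/\ forall x i, (g i \in axes (f x)) = (i \in axes x),
        forall i, (g i \in open_ix M) = (i \in open_ix N) &
        forall x, (f x \in green M) = (x \in green N)]].

Inductive btree (X : Type) : Type :=
  | Leaf of X
  | Node of btree X & btree X.

Fixpoint leaves (X : Type) (t : btree X) : seq X :=
  match t with
  | Leaf x => [:: x]
  | Node a b => leaves a ++ leaves b
  end.

(* Equality of trees whose nodes have unordered children. *)
Fixpoint same_tree (X : eqType) (s t : btree X) : bool :=
  match s, t with
  | Leaf x, Leaf y => x == y
  | Node a b, Node c d => (same_tree a c && same_tree b d)
                          || (same_tree a d && same_tree b c)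
  | _, _ => false
  end.

(* Each step is given by its pair of operands. *)
Fixpoint steps (X : Type) (t : btree X) : seq (btree X * btree X) :=
  match t with
  | Leaf _ => [::]
  | Node a b => (a, b) :: steps a ++ steps b
  end.

(* Each tensor of the network labels exactly one leaf. *)
Record ctree (N : network) := CTree {
  ctree_tree :> btree (tensor N);
  ctreeP : perm_eq (leaves ctree_tree) (enum (tensor N))
}.

Section Volumes.
Variable N : network.
Implicit Types (t : btree (tensor N)) (s : btree (tensor N) * btree (tensor N)).

Definition carried (S : {set tensor N}) : {set ix N} :=
  [set i | [exists x in S, i \in axes x]
           && ((i \in open_ix N) || [exists x in ~: S, i \in axes x])].

Definition operand_ix t : {set ix N} := carried [set x in leaves t].

Definition step_volume s : nat :=
  \prod_(i in operand_ix s.1 :|: operand_ix s.2) dim i.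

Definition green_operand t : bool := has (mem (green N)) (leaves t).

Definition is_merge s : bool := green_operand s.1 && green_operand s.2.
Definition is_ride s : bool := green_operand s.1 (+) green_operand s.2.

Definition volume t : nat := \sum_(s <- steps t) step_volume s.
Definition merge_volume t : nat := \sum_(s <- steps t | is_merge s) step_volume s.
Definition ride_volume t : nat := \sum_(s <- steps t | is_ride s) step_volume s.

End Volumes.

Local Open Scope ring_scope.

Definition merge_frac (R : realType) (N : network) (T : ctree N) : R :=
  (merge_volume T)%:R / (volume T)%:R.

Definition ride_frac (R : realType) (N : network) (T : ctree N) : R :=
  (ride_volume T)%:R / (volume T)%:R.

Definition cost (R : realType) (N : network) (T : ctree N) : R :=
  (1 + 2 * merge_frac R T + ride_frac R T) * (volume T)%:R.

Local Close Scope ring_scope.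

Fixpoint height (X : Type) (t : btree X) : nat :=
  match t with
  | Leaf _ => 0
  | Node a b => (maxn (height a) (height b)).+1
  end.

Lemma height_lt_size (X : Type) (t : btree X) : height t < size (leaves t).
Proof.
elim: t => //= a Ha b Hb; rewrite size_cat.
have a0 := leq_ltn_trans (leq0n _) Ha; have b0 := leq_ltn_trans (leq0n _) Hb.
by case: (leqP (height a) (height b)) => _; [exact: leq_add a0 Hb|
  rewrite addnC; exact: leq_add b0 Ha].
Qed.

Lemma bounded_btree_finite (X : finType) (n : nat) :
  exists s : seq (btree X), forall t, height t < n -> List.In t s.
Proof.
elim: n => [|n [s Hs]]; first by exists [::].
exists (List.map (@Leaf X) (enum X)
        ++ List.map (fun p => Node p.1 p.2) (List.list_prod s s)).
have inP (x : X) (l : seq X) : x \in l -> List.In x l.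
  by elim: l => //= y l IH; rewrite inE => /orP[/eqP->|/IH]; [left|right].
case=> [x _|a b] /=.
  apply/List.in_or_app; left; apply/List.in_map/inP.
  by rewrite mem_enum.
rewrite ltnS gtn_max => /andP[/Hs ha /Hs hb].
apply/List.in_or_app; right.
by apply: (List.in_map (fun p => Node p.1 p.2) _ (a, b)); apply: List.in_prod.
Qed.

Lemma ctree_finite (N : network) :
  exists s : seq (ctree N), forall T, List.In T s.
Proof.
have [s Hs] := bounded_btree_finite (tensor N) #|tensor N|.
pose mk t := if boolP (perm_eq (leaves t) (enum (tensor N))) is AltTrue p
             then Some (CTree p) else None.
exists (pmap mk s) => -[t p].
have /Hs : height t < #|tensor N|.
  by rewrite cardE -(perm_size p) height_lt_size.
elim: s {Hs} => //= u s IH [->|/IH {}IH].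
  rewrite /mk; case: {-}_ / boolP => [q|]; last by rewrite p.
  by left; rewrite (bool_irrelevance q p).
by case: (mk u) => //= T; right.
Qed.

Lemma ctree_inhabited (N : network) : inhabited (ctree N).
Proof.
have [t Ht] : exists t : btree (tensor N), leaves t = enum (tensor N).
  have : 0 < size (enum (tensor N)) by rewrite -cardE (ltnW (tensor_gt1 N)).
  elim: (enum _) => // x [|y l] IH _; first by exists (Leaf x).
  by have [//|t Ht] := IH; exists (Node (Leaf x) t); rewrite /= Ht.
by constructor; apply: (@CTree N t); rewrite Ht.
Qed.

Lemma ex_ctree_min (N : network) d (O : orderType d) (f : ctree N -> O) :
  exists T, forall T', (f T <= f T')%O.
Proof.
have [s Hs] := ctree_finite N; have [T0] := ctree_inhabited N.
suff [T HT] : exists T, forall T', List.In T' s -> (f T <= f T')%O.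
  by exists T => T'; apply/HT/Hs.
elim: s {Hs} => [|U s [T HT]]; first by exists T0.
case: (leP (f U) (f T)) => [UT|/ltW TU].
  by exists U => T' /= [<-//|/HT]; apply: le_trans.
by exists T => T' /= [<-//|/HT].
Qed.

Definition ctree_min (N : network) d (O : orderType d) (f : ctree N -> O) : O :=
  f (projT1 (cid (ex_ctree_min f))).

Lemma ctree_min_le (N : network) d (O : orderType d) (f : ctree N -> O) T :
  (ctree_min f <= f T)%O.
Proof. exact: (projT2 (cid (ex_ctree_min f))). Qed.

Lemma ctree_min_attained (N : network) d (O : orderType d) (f : ctree N -> O) :
  exists T, f T = ctree_min f.
Proof. by exists (projT1 (cid (ex_ctree_min f))). Qed.

Definition min_volume (N : network) : nat :=
  ctree_min (fun T : ctree N => volume T).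

Definition min_cost (R : realType) (N : network) : R :=
  ctree_min (fun T : ctree N => cost R T).

Definition skeleton_optimal (N : network) (T : ctree N) : Prop :=
  volume T = min_volume N.

(* Main.v *)
Require Import Defs.
From HB Require Import structures.
From mathcomp Require Import all_boot all_order all_algebra.
From mathcomp Require Import reals.
From mathcomp Require Import zify lra.

(** For the ratio 2, take a vector-matrix-vector chain u - A - w with u green and
    bonds of dimensions p = q + 1 (between u and A) and q (between A and w), and a
    second, scalar, green tensor.  The step consuming A always has volume p q; the
    cheapest tree is ((u A) w), of volume p q + q, in which that step is a ride,
    whereas (u (A w)) has volume p q + p only and makes that step a pass.  The green
    scalar is best contracted last, at volume 1. *)

Set Implicit Arguments.
Unset Strict Implicit.
Unset Printing Implicit Defensive.

Import Order.TTheory GRing.Theory Num.Theory.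
Local Open Scope ring_scope.

(** * Bounds valid for every network *)

Section CostBounds.
Variables (R : realType) (N : network).
Implicit Types T : ctree N.

Lemma volume_gt0 T : (0 < volume T)%N.
Proof.
case: T => -[x|a b] /= p.
  by move: (perm_size p) (tensor_gt1 N); rewrite -cardE /= => <-.
rewrite /volume /= big_cons addn_gt0; apply/orP; left.
by apply: prodn_cond_gt0 => i _; apply: dim_gt0.
Qed.

(** Positivity of the volume lets the denominators of both fractions cancel. The cost becomes a
    natural number, so costs can be compared by integer arithmetic. *)
Lemma costE T :
  cost R T = (volume T + 2 * merge_volume T + ride_volume T)%N%:R.
Proof.
have V0 : (volume T)%:R != 0 :> R by rewrite pnatr_eq0 -lt0n volume_gt0.
by rewrite 2!natrD natrM /cost /merge_frac /ride_frac 2!mulrDl mul1r -mulrA !divfK.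
Qed.

(** No step is both a merge and a ride: one is a conjunction, the other an exclusive or, of the same
    two booleans. Doubling this bound yields the factor 3 in [cost_le]. *)
Lemma merge_ride_volume_le T : (merge_volume T + ride_volume T <= volume T)%N.
Proof.
rewrite /merge_volume /ride_volume /volume.
rewrite (big_mkcond (@is_merge N)) (big_mkcond (@is_ride N)) -big_split /=.
apply: leq_sum => s _; rewrite /is_merge /is_ride.
by case: (green_operand _) (green_operand _) => -[] //=; rewrite addn0.
Qed.

Lemma cost_le T : cost R T <= 3 * (volume T)%:R.
Proof. by rewrite costE -natrM ler_nat; have := merge_ride_volume_le T; lia. Qed.

Lemma min_volume_le T : (min_volume N <= volume T)%N.
Proof. exact: (ctree_min_le (fun T : ctree N => volume T)). Qed.

(** Merges and rides only add to the volume, so a cheapest tree already costs at least its own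
    volume. *)
Lemma min_volume_le_cost : (min_volume N)%:R <= min_cost R N.
Proof.
have [T] := ctree_min_attained (fun T : ctree N => cost R T).
rewrite /min_cost => <-; rewrite costE ler_nat -addnA.
by apply: leq_trans (leq_addr _ _); apply: min_volume_le.
Qed.

Lemma min_volume_gt0 : (0 < min_volume N)%N.
Proof.
have [T] := ctree_min_attained (fun T : ctree N => volume T).
by rewrite /min_volume => <-; apply: volume_gt0.
Qed.

Lemma min_cost_gt0 : 0 < min_cost R N.
Proof. by apply: lt_le_trans min_volume_le_cost; rewrite ltr0n min_volume_gt0. Qed.

End CostBounds.

(** * Shapes of binary trees with at most four leaves *)

Section SmallTrees.
Variable X : Type.
Implicit Types t : btree X.

Lemma size_leaves_gt0 t : (0 < size (leaves t))%N.
Proof. exact: leq_ltn_trans (height_lt_size t). Qed.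

Lemma btree_of_size1 t : size (leaves t) = 1%N -> exists x, t = Leaf x.
Proof.
case: t => [x _|a b]; first by exists x.
by rewrite /= size_cat; have := size_leaves_gt0 a; have := size_leaves_gt0 b; lia.
Qed.

Lemma btree_of_size2 t : size (leaves t) = 2%N ->
  exists x y, t = Node (Leaf x) (Leaf y).
Proof.
case: t => [//|a b] /=; rewrite size_cat => ab.
have a0 := size_leaves_gt0 a; have b0 := size_leaves_gt0 b.
have [|x ->] := @btree_of_size1 a; first lia.
have [|y ->] := @btree_of_size1 b; first lia.
by exists x, y.
Qed.

Lemma btree_of_size3 t : size (leaves t) = 3%N ->
  exists x y z, t = Node (Leaf x) (Node (Leaf y) (Leaf z)) \/
                t = Node (Node (Leaf x) (Leaf y)) (Leaf z).
Proof.
case: t => [//|a b] /=; rewrite size_cat => ab.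
have a0 := size_leaves_gt0 a; have b0 := size_leaves_gt0 b.
have [a1|a2] : size (leaves a) = 1%N \/ size (leaves a) = 2%N by lia.
- have [x ->] := btree_of_size1 a1.
  have [|y [z ->]] := @btree_of_size2 b; first lia.
  by exists x, y, z; left.
- have [x [y ->]] := btree_of_size2 a2.
  have [|z ->] := @btree_of_size1 b; first lia.
  by exists x, y, z; right.
Qed.

(** Children are ordered here, hence five shapes, a Catalan number. They make the search over all
    trees of the chain a finite case analysis. *)
Lemma btree_of_size4 t : size (leaves t) = 4%N ->
  exists x y z w,
    [\/ t = Node (Leaf x) (Node (Leaf y) (Node (Leaf z) (Leaf w))),
        t = Node (Leaf x) (Node (Node (Leaf y) (Leaf z)) (Leaf w)),
        t = Node (Node (Leaf x) (Leaf y)) (Node (Leaf z) (Leaf w)) |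
        t = Node (Node (Leaf x) (Node (Leaf y) (Leaf z))) (Leaf w) \/
        t = Node (Node (Node (Leaf x) (Leaf y)) (Leaf z)) (Leaf w)].
Proof.
case: t => [//|a b] /=; rewrite size_cat => ab.
have a0 := size_leaves_gt0 a; have b0 := size_leaves_gt0 b.
have [a1|[a2|a3]] : size (leaves a) = 1%N \/ size (leaves a) = 2%N \/
  size (leaves a) = 3%N by lia.
- have [x ->] := btree_of_size1 a1.
  have [|y [z [w [->| ->]]]] := @btree_of_size3 b; first lia.
  + by exists x, y, z, w; constructor 1.
  + by exists x, y, z, w; constructor 2.
- have [x [y ->]] := btree_of_size2 a2.
  have [|z [w ->]] := @btree_of_size2 b; first lia.
  by exists x, y, z, w; constructor 3.
- have [x [y [z a_eq]]] := btree_of_size3 a3.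
  have [|w ->] := @btree_of_size1 b; first lia.
  by exists x, y, z, w; constructor 4; case: a_eq => ->; [left|right].
Qed.

End SmallTrees.

(** * The chain networks *)

Inductive site := U | A | W | G.

Definition site_code (x : site) : bool * bool :=
  match x with
  | U => (true, true) | A => (true, false) | W => (false, true) | G => (false, false)
  end.

Definition site_decode (c : bool * bool) : site :=
  match c with
  | (true, true) => U | (true, false) => A | (false, true) => W | (false, false) => G
  end.

Lemma site_codeK : cancel site_code site_decode. Proof. by case. Qed.

HB.instance Definition _ := Finite.copy site (can_type site_codeK).

(* The bond [true] joins [U] and [A], the bond [false] joins [A] and [W]. *)
Definition on_bond (i : bool) (x : site) : bool :=
  match x with U => i | A => true | W => ~~ i | G => false end.

Definition sites := [:: U; A; W; G].

Lemma mem_sites x : x \in sites. Proof. by case: x. Qed.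

Lemma perm_sites : perm_eq sites (enum {: site}).
Proof. by apply: uniq_perm; rewrite ?enum_uniq // => x; rewrite mem_enum mem_sites. Qed.

Lemma card_site : #|{: site}| = 4.
Proof. by rewrite cardE -(perm_size perm_sites). Qed.

Lemma on_bond_shared i : (1 < #|[set x | i \in [set j | on_bond j x]]|)%N.
Proof.
apply: (@leq_trans #|[set A; if i then U else W]|); first by case: i; rewrite cards2.
by apply/subset_leq_card/subsetP => x; rewrite !inE => /orP[] /eqP ->; case: i.
Qed.

Definition bond_dim (q : nat) (i : bool) : nat := if i then q.+1 else q.

Lemma bond_dim_gt0 q i : (0 < bond_dim q.+1 i)%N. Proof. by case: i. Qed.

(* The bonds have dimensions [q + 2] and [q + 1], so that both are positive for every
   [q]; the cheapest tree is unique only for [0 < q]. *)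
Definition chain (q : nat) : network.
Proof.
refine (@Network site bool (bond_dim q.+1) (fun x => [set i | on_bond i x])
  set0 [set U; G] _ (bond_dim_gt0 q) _ (fun i _ => on_bond_shared i) _).
- by rewrite card_site.
- by move=> i; exists A; rewrite inE.
- by rewrite cards2.
Defined.

(** The sum of all index dimensions is invariant under isomorphism, and for [chain q] it equals
    [2 * q + 3]. *)
Lemma chain_isomorphic_inj j k : isomorphic (chain j) (chain k) -> j = k.
Proof.
move=> [f [g [_ gbij dimg _]]].
have : (\sum_i bond_dim j.+1 i = \sum_i bond_dim k.+1 i)%N.
  rewrite [RHS](reindex g) /=; last exact: onW_bij.
  by apply: eq_bigr => i _; rewrite (esym (dimg i) : bond_dim j.+1 i = _).
by rewrite !big_bool /=; lia.
Qed.

(** * Volumes and costs of trees over the chain *)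

Section Chain.
Variable q : nat.
Implicit Types t : btree site.

(** A form of [carried] that evaluates on explicit lists of leaves. No bond is open, so a bond
    survives exactly when it has an end on each side. *)
Definition crosses (i : bool) (s : seq site) : bool :=
  has (on_bond i) s && has (on_bond i) [seq x <- sites | x \notin s].

Lemma mem_operand_ix i t :
  (i \in @operand_ix (chain q) t) = crosses i (leaves t).
Proof.
rewrite !inE; congr (_ && _); apply/existsP/hasP.
- by move=> [x]; rewrite !inE => /andP[]; exists x.
- by move=> [x xt xi]; exists x; rewrite !inE xt.
- move=> [x]; rewrite !inE => /andP[xt xi].
  by exists x; rewrite // mem_filter xt mem_sites.
- by move=> [x]; rewrite mem_filter => /andP[xt _] xi; exists x; rewrite !inE xt.
Qed.

Lemma chain_step_volume (s : btree site * btree site) :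
  @step_volume (chain q) s =
  ((if crosses true (leaves s.1) || crosses true (leaves s.2) then q.+2 else 1) *
   (if crosses false (leaves s.1) || crosses false (leaves s.2) then q.+1 else 1))%N.
Proof.
by rewrite /step_volume big_mkcond big_bool !in_setU !mem_operand_ix.
Qed.

Lemma chain_green_operand t :
  @green_operand (chain q) t = has (mem [:: U; G]) (leaves t).
Proof. by apply: eq_has => x; rewrite !inE. Qed.

Definition ride_tree : ctree (chain q) :=
  @CTree (chain q) (Node (Node (Node (Leaf U) (Leaf A)) (Leaf W)) (Leaf G)) perm_sites.

Lemma perm_pass_sites : perm_eq [:: A; W; U; G] (enum {: site}).
Proof. by apply: perm_trans perm_sites. Qed.

Definition pass_tree : ctree (chain q) :=
  @CTree (chain q) (Node (Node (Node (Leaf A) (Leaf W)) (Leaf U)) (Leaf G)) perm_pass_sites.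

Lemma ride_tree_cost (R : realType) :
  cost R ride_tree = (2 * (q.+2 * q.+1) + 2 * q.+1 + 3)%N%:R.
Proof.
rewrite costE /volume /merge_volume /ride_volume /= !big_cons !big_nil.
rewrite /is_merge /is_ride !chain_step_volume !chain_green_operand /=.
by congr (_%:R); lia.
Qed.

Lemma pass_tree_cost (R : realType) :
  cost R pass_tree = (q.+2 * q.+1 + 2 * q.+2 + 3)%N%:R.
Proof.
rewrite costE /volume /merge_volume /ride_volume /= !big_cons !big_nil.
rewrite /is_merge /is_ride !chain_step_volume !chain_green_operand /=.
by congr (_%:R); lia.
Qed.

(** The equality case of [?= iff] gives uniqueness along with minimality. At [q = 0] uniqueness
    fails: contracting [G] with [W] first then costs [q.+1 = 1], as much as contracting [G] last. *)
Lemma ride_tree_unique_min (T : ctree (chain q)) : (0 < q)%N ->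
  (volume ride_tree <= volume T ?= iff same_tree ride_tree T)%N.
Proof.
move=> q_gt0.
have volE t : @volume (chain q) t = (\sum_(s <- steps t)
    (if crosses true (leaves s.1) || crosses true (leaves s.2) then q.+2 else 1) *
    (if crosses false (leaves s.1) || crosses false (leaves s.2) then q.+1 else 1))%N.
  by apply: eq_bigr => s _; rewrite chain_step_volume.
case: T => t /= tP; rewrite !volE.
have tS : perm_eq (leaves t) sites by apply: perm_trans tP _; rewrite perm_sym perm_sites.
have shape := btree_of_size4 (perm_size tS); apply/leqifP; move: shape tS => {tP}.
(* The permutation hypothesis rules out repeated labels, leaving 24 labellings of each shape. In
   each of them the volumes are explicit polynomials in [q]. *)
move=> [x [y [z [w [ ->| ->| -> | [-> | -> ]]]]]] /=;
  case: x; case: y => //; case: z => //; case: w => //= _; rewrite !big_cons !big_nil /=; lia.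
Qed.

End Chain.

Lemma ride_tree_optimal q : (0 < q)%N -> skeleton_optimal (ride_tree q).
Proof.
move=> q_gt0; apply/eqP; rewrite eqn_leq.
rewrite min_volume_le andbT /min_volume.
have [T <-] := ctree_min_attained (fun T : ctree (chain q) => volume T).
exact: (ride_tree_unique_min T q_gt0).
Qed.

Lemma chain_skeleton_optimal q (T : ctree (chain q)) : (0 < q)%N ->
  skeleton_optimal T -> same_tree (ride_tree q) T.
Proof.
move=> q_gt0 Tmin; rewrite -(ride_tree_unique_min T q_gt0) Tmin.
by rewrite ride_tree_optimal.
Qed.

Lemma ride_tree_cost_ratio (R : realType) q (eps : R) :
  0 < eps -> (0 < q)%N -> 9 < eps * q%:R ->
  (2 - eps) * min_cost R (chain q) <= cost R (ride_tree q).
Proof.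
move=> eps_gt0; rewrite -(ler1n R) => q_ge1 q_gt.
have := min_cost_gt0 R (chain q).
have : min_cost R (chain q) <= cost R (pass_tree q).
  exact: (ctree_min_le (fun T : ctree (chain q) => cost R T)).
rewrite pass_tree_cost ride_tree_cost -[q.+2]addn2 -[q.+1]addn1.
rewrite !(natrD, natrM) /=.
move: (min_cost _ _) (q%:R : R) q_ge1 q_gt => c x x_ge1 x_gt c_le c_gt0.
(* With [x = q], the pass tree costs [x^2 + 5x + 9] and the ride tree [2x^2 + 8x + 9]. What is
   needed is [2x + 9 <= eps * (x^2 + 5x + 9)], which this bound more than covers. *)
have x59 : 9 * (x + 5) <= eps * x * (x + 5) by rewrite ler_wpM2r ?ltW //; lra.
(* Replacing the minimal cost by that of the pass tree requires [2 - eps] to be nonnegative;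
   otherwise the left side is at most 0. *)
have [eps2|/ltW eps2] := lerP eps 2; last first.
  have : (2 - eps) * c <= 0 by rewrite mulr_le0_ge0 ?subr_le0 // ltW.
  by move/le_trans; apply; nra.
apply: le_trans (ler_wpM2l _ c_le) _; first by rewrite subr_ge0.
by nra.
Qed.

Theorem theorem8 (R : realType) :
  (forall eps : R, 0 < eps ->
     exists N : nat -> network,
       (forall j k : nat, isomorphic (N j) (N k) -> j = k) /\
       (forall k : nat,
          #|green (N k)| = 2%N /\
          exists T0 : ctree (N k),
            [/\ skeleton_optimal T0,
                (forall T : ctree (N k), skeleton_optimal T -> same_tree T0 T) &
                cost R T0 >= (2 - eps) * min_cost R (N k)]))
  /\
  (forall (N : network) (T0 : ctree N), skeleton_optimal T0 ->
     [/\ cost R T0 <= 3 * (min_volume N)%:R,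
         3 * (min_volume N)%:R <= 3 * min_cost R N &
         cost R T0 / min_cost R N <= 3]).
Proof.
split=> [eps eps_gt0|N T0 T0min].
  (* Every member of the family must reach the ratio, so the parameters start beyond [9 / eps]; the
     successor in [K.+1] makes them visibly positive. *)
  pose K := Num.bound (9 / eps).
  have K_gt : 9 < eps * K%:R.
    by rewrite mulrC -ltr_pdivrMr // archi_boundP // divr_ge0 // ltW.
  exists (fun k => chain (k + K.+1)); split=> [j k /chain_isomorphic_inj|k].
    by lia.
  set q := (k + K.+1)%N; have q_gt0 : (0 < q)%N by rewrite /q addnS.
  split; first by rewrite cards2.
  exists (ride_tree q); split=> [|T|]; last 1 first.
  - apply: ride_tree_cost_ratio => //; apply: lt_le_trans K_gt _.
    by rewrite ler_pM2l // ler_nat /q; lia.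
  - exact: ride_tree_optimal.
  - exact: chain_skeleton_optimal.
have cost_T0 : cost R T0 <= 3 * (min_volume N)%:R by rewrite -T0min cost_le.
have min_le : 3 * (min_volume N)%:R <= 3 * min_cost R N.
  by rewrite ler_pM2l // min_volume_le_cost.
split=> //; rewrite ler_pdivrMr ?min_cost_gt0 //; exact: le_trans min_le.
Qed.
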